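(* Let $\pi$ be a degree sequence of some tree with boundary, and let $\mathcal{T}_\pi$ be the class of all trees with boundary with degree sequence $\pi$. A tree $G\in\mathcal{T}_\pi$ has the Faber-Krahn property in $\mathcal{T}_\pi$ if and only if $G$ is an SLO$^\ast$-tree. Such a $G$ is uniquely determined up to isomorphism.
   Context: A tree with boundary is a finite tree $G=(V,E)$ whose vertex set is partitioned into the set $\partial V$ of boundary vertices, which are exactly the vertices of degree $1$, and the set $V_0$ of interior vertices, which are exactly the vertices of degree at least $2$; both sets are nonempty. The degree sequence of $G$ is the multiset of its vertex degrees. The Dirichlet operator $\Delta_0$ is the principal submatrix of the graph Laplacian $D-A$ of $G$ (degrees taken in $G$) indexed by $V_0$; $\lambda(G)$ is its smallest eigenvalue. $G$ has the Faber-Krahn property in a class $\mathcal{C}\ni G$ if $\lambda(G)\le\lambda(H)$ for all $H\in\mathcal{C}$. For a tree with a chosen root $v_0$, the height of $v$ is $h(v)=\mathrm{dist}(v,v_0)$; if $v,w$ are adjacent and $h(w)=h(v)+1$, then $v$ is the parent of $w$ and $w$ a child of $v$. A total order $\prec$ on $V$ is spiral-like (SLO) for root $v_0$ if: (S1) $v\prec w$ implies $h(v)\le h(w)$; (S2) if $v_1\prec v_2$ then every child of $v_1$ precedes every child of $v_2$; (S3) if $v\prec w$ and $v\in\partial V$ then $w\in\partial V$. It is an SLO$^\ast$-ordering if additionally (S4) for interior vertices $v\prec w$ implies $d_v\le d_w$ ($d_v$ the degree). An SLO$^\ast$-tree is a tree with boundary admitting an SLO$^\ast$-ordering for some root. 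*)

(* Defs.v *)
From HB Require Import structures.
From mathcomp Require Import all_boot all_order all_algebra perm.
From mathcomp Require Import reals.
Set Implicit Arguments. Unset Strict Implicit. Unset Printing Implicit Defensive.
Import Order.TTheory GRing.Theory Num.Theory.
Local Open Scope ring_scope.

Section Trees.
Variable n : nat.
Implicit Types (e : rel 'I_n) (u v w : 'I_n).

Definition simple_graph e := symmetric e /\ irreflexive e.

Definition deg e v : nat := #|[set w | e v w]|.

Definition nedges e : nat := #|[set p : 'I_n * 'I_n | e p.1 p.2 && (p.1 < p.2)%N]|.

Definition connected e := forall u v, connect e u v.

Definition is_tree e := [/\ simple_graph e, connected e & nedges e = n.-1].

Definition boundary e : {set 'I_n} := [set v | deg e v == 1%N].
Definition interior e : {set 'I_n} := [set v | (2 <= deg e v)%N].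

Definition tree_with_boundary e :=
  [/\ is_tree e, boundary e != set0 & interior e != set0].

(* degree sequence as a multiset (a sequence up to permutation) *)
Definition degseq e : seq nat := [seq deg e v | v <- enum 'I_n].

Fixpoint nball e (k : nat) u : {set 'I_n} :=
  if k is k'.+1 then
    nball e k' u :|: [set w | [exists x in nball e k' u, e x w]]
  else [set u].

Definition dist e u v : nat := find (fun k => v \in nball e k u) (iota 0 n).

Definition laplacian (R : nzRingType) e u v : R :=
  if u == v then ((deg e u)%:R) else if e u v then -1 else 0.

Definition dirichlet (R : nzRingType) e : 'M[R]_#|interior e| :=
  \matrix_(i, j) laplacian R e (enum_val i) (enum_val j).

Definition smallest_eigenvalue (R : realType) m (A : 'M[R]_m) (l : R) :=
  eigenvalue A l /\ forall mu, eigenvalue A mu -> l <= mu.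

Definition same_class e e' := tree_with_boundary e' /\ perm_eq (degseq e') (degseq e).

Definition faber_krahn (R : realType) e :=
  exists lG : R, smallest_eigenvalue (dirichlet R e) lG /\
    forall e' (lH : R), same_class e e' ->
      smallest_eigenvalue (dirichlet R e') lH -> lG <= lH.

Definition child e v0 v w := e v w && (dist e v0 w == (dist e v0 v).+1).

(* a total order on V, given as v < w iff rk v < rk w for a bijection rk *)
Definition SLO e v0 (rk : {perm 'I_n}) :=
  let prec v w := (rk v < rk w)%N in
  [/\ (forall v w, prec v w -> (dist e v0 v <= dist e v0 w)%N),
      (forall v1 v2 c1 c2, prec v1 v2 -> child e v0 v1 c1 -> child e v0 v2 c2 ->
          prec c1 c2)
    & (forall v w, prec v w -> v \in boundary e -> w \in boundary e)].

Definition SLO_star e v0 (rk : {perm 'I_n}) :=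
  SLO e v0 rk /\
  forall v w, v \in interior e -> w \in interior e -> (rk v < rk w)%N ->
    (deg e v <= deg e w)%N.

Definition SLO_star_tree e :=
  tree_with_boundary e /\ exists v0 (rk : {perm 'I_n}), SLO_star e v0 rk.

Definition isomorphic e e' :=
  exists f : {perm 'I_n}, forall u v, e' (f u) (f v) = e u v.

End Trees.

(* Main.v *)
Require Import Defs.
From HB Require Import structures.
From mathcomp Require Import boolp classical_sets.
From mathcomp Require Import all_boot all_order all_algebra perm.
From mathcomp Require Import reals.
From mathcomp Require Import zify ring lra.
Set Implicit Arguments. Unset Strict Implicit. Unset Printing Implicit Defensive.
Import Order.TTheory GRing.Theory Num.Theory.
Local Open Scope ring_scope.

(** Let f > 0 be the ground state of a tree minimizing the first Dirichlet
    eigenvalue in its degree class. Redirecting edges between two vertices v and w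
    without changing the degree multiset changes the energy of f by an explicit
    product, which must be nonnegative; when it vanishes, f is also a ground state of
    the modified tree, and comparing the eigenvalue equations forces equalities
    between values of f. Swapping one child of v with one child of w shows that,
    rooted at a maximum of f, the values decrease away from the root and children
    inherit the f-order of their parents; moving deg v - deg w children from v to w
    shows that larger values have smaller degrees. Sorting by height, then parents,
    then f is thus an SLO*-ordering. Conversely the degree multiset and monotonicity
    of the parent map determine an SLO*-tree, so it is isomorphic to a minimizer,
    which exists because the class is finite. *)

(** * Smallest eigenvalue of a real symmetric matrix and its variational bound *)

Section QuadraticForms.
Variable R : realType.

(** Each product of two coordinates is at most the squared norm in absolute value, so the sum of the
    absolute entries works; the added [1] makes [K] positive. *)
Lemma form_bound m (A : 'M[R]_m) : exists2 K : R, 0 < K &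
  forall x : 'rV_m, `|(x *m A *m x^T) 0 0| <= K * (x *m x^T) 0 0.
Proof.
have normE (x : 'rV[R]_m) : (x *m x^T) 0 0 = \sum_i x 0 i ^+ 2.
  by rewrite mxE; apply: eq_bigr => i _; rewrite mxE expr2.
exists (1 + \sum_i \sum_j `|A j i|) => [|x].
  by rewrite ltr_pwDl // sumr_ge0 // => i _; apply: sumr_ge0.
have x2 i : x 0 i ^+ 2 <= (x *m x^T) 0 0.
  by rewrite normE (bigD1 i) //= lerDl sumr_ge0 // => j _; rewrite sqr_ge0.
have x0 : 0 <= (x *m x^T) 0 0.
  by rewrite normE sumr_ge0 // => j _; rewrite sqr_ge0.
have xx i j : `|x 0 i| * `|x 0 j| <= (x *m x^T) 0 0.
  have := x2 i; have := x2 j; rewrite -(real_normK (num_real (x 0 i))).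
  rewrite -(real_normK (num_real (x 0 j))) => h1 h2.
  have := sqr_ge0 (`|x 0 i| - `|x 0 j|); nra.
rewrite mulrDl mul1r -[leLHS]add0r lerD // mulr_suml mxE.
apply: le_trans (ler_norm_sum _ _ _) _; apply: ler_sum => i _.
rewrite mxE mulr_suml mulr_suml.
apply: le_trans (ler_norm_sum _ _ _) _; apply: ler_sum => j _.
by rewrite !normrM [x^T i 0]mxE mulrAC mulrC ler_wpM2l.
Qed.

Lemma form_subM m (A : 'M[R]_m) (l : R) (x y : 'rV_m) :
  (x *m (A - l%:M) *m y^T) 0 0 = (x *m A *m y^T) 0 0 - l * (x *m y^T) 0 0.
Proof. by rewrite mulmxBr mulmxBl mul_mx_scalar -scalemxAl !mxE. Qed.

(** The eigenvalue is the supremum of the [t] for which [A - t] is positive semidefinite. If [A]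
    minus the supremum were invertible, a bound on the form of its inverse would leave room to
    increase [t]. *)
Lemma symmetric_min_eigenvalue m (A : 'M[R]_m) : (0 < m)%N -> A^T = A ->
  exists l, eigenvalue A l /\
    forall x : 'rV_m, l * (x *m x^T) 0 0 <= (x *m A *m x^T) 0 0.
Proof.
case: m A => // m A _ symA.
pose E : set R := [set t | forall x : 'rV_m.+1,
  t * (x *m x^T) 0 0 <= (x *m A *m x^T) 0 0]%classic.
have xx0 (x : 'rV[R]_m.+1) : 0 <= (x *m x^T) 0 0.
  by rewrite mxE sumr_ge0 // => j _; rewrite mxE -expr2 sqr_ge0.
have [K K0 KA] := form_bound A.
have EK : E (- K).
  by move=> x; rewrite mulNr lerNl; have := KA x; rewrite ler_norml => /andP[h _]; rewrite lerNl.
have Eub : has_ubound E.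
  exists (A 0 0) => t /(_ (delta_mx 0 0)).
  rewrite -rowE trmx_delta -colE !mxE (bigD1 0) //= big1 => [|j /negbTE j0].
    by rewrite !mxE eqxx addr0 mulr1 mul1r.
  by rewrite !mxE j0 andbF mul0r.
have supE : has_sup E by split => //; exists (- K).
exists (sup E).
have El : E (sup E).
  move=> x; have [x0|x0] := eqVneq ((x *m x^T) 0 0) 0.
    by rewrite x0 mulr0; have := EK x; rewrite x0 mulr0.
  have xp : 0 < (x *m x^T) 0 0 by rewrite lt_neqAle eq_sym x0 xx0.
  rewrite -ler_pdivlMr //; apply: sup_le_ub; first by exists (- K).
  by move=> t /(_ x); rewrite ler_pdivlMr.
split=> //; apply: contraT; rewrite /eigenvalue /eigenspace negbK kermx_eq0 row_free_unit.
set B := A - _ => uB.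
have symB : B^T = B by rewrite /B linearB /= symA tr_scalar_mx.
have [k k0 kB] := form_bound (invmx B).
suff : E (sup E + k^-1).
  move=> /(ub_le_sup Eub); have := k0; rewrite -invr_gt0; lra.
move=> x.
pose s := (x *m x^T) 0 0; pose a := (x *m B *m x^T) 0 0.
suff : k^-1 * s <= a by rewrite /a form_subM /s mulrDl; lra.
(* Semidefiniteness of [B] at [x - y] gives [0 <= a - 2 s / k + (x B^-1 x^T) / k^2]; the last term
   is at most [s / k] by the choice of [k], hence [s / k <= a]. *)
pose y := k^-1 *: (x *m invmx B).
have symC : (invmx B)^T = invmx B by rewrite trmx_inv symB.
have /= : 0 <= ((x - y) *m B *m (x - y)^T) 0 0.
  by rewrite form_subM subr_ge0; apply: El.
have -> : (x - y) *m B *m (x - y)^T = x *m B *m x^T - (k^-1 *+ 2) *: (x *m x^T)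
   + k^-1 ^+ 2 *: (x *m invmx B *m x^T).
  rewrite /y; move: symC uB; move: (B) => B' symC uB.
  have -> : (x - k^-1 *: (x *m invmx B'))^T = x^T - k^-1 *: (invmx B' *m x^T).
    by rewrite [LHS]linearB /= [X in _ - X]linearZ /= trmx_mul symC.
  rewrite !mulmxBl !mulmxBr -!scalemxAl -!scalemxAr.
  rewrite mulmxKV // !mulmxA mulmxK // scalerA.
  rewrite opprB mulr2n scalerDl opprD expr2 !addrA.
  by rewrite -!addrA; congr (_ + _); congr (_ + _); rewrite addrC.
move=> h0; have h : 0 <= a - k^-1 *+ 2 * s + k^-1 ^+ 2 * (x *m invmx B *m x^T) 0 0.
  by move: h0; rewrite /a /s !mxE.
have := kB x; rewrite ler_norml -/s => /andP[_ hk].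
have hk2 : k^-1 ^+ 2 * (x *m invmx B *m x^T) 0 0 <= k^-1 * s.
  rewrite expr2 -mulrA ler_wpM2l ?invr_ge0 ?(ltW k0) // -[s](mulKf (lt0r_neq0 k0)).
  by rewrite ler_wpM2l ?invr_ge0 ?(ltW k0).
rewrite mulr2n mulrDl in h; lra.
Qed.
End QuadraticForms.

(** * Dirichlet energy, Rayleigh quotient and positive ground states *)

Section Energy.
Variables (R : realType) (n : nat).
Implicit Types (e : rel 'I_n) (f g : 'I_n -> R) (u v w : 'I_n) (l : R).

Definition lap e f u : R := \sum_v (e u v)%:R * (f u - f v).
Definition energy e f : R := \sum_u f u * lap e f u.
Definition sqnorm f : R := \sum_u f u ^+ 2.
(** Extension by zero replaces vectors indexed by [interior e], whose type varies with [e], by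
    functions on a fixed type, so that one [f] can be tested on several trees. *)
Definition supported e f := forall u, u \notin interior e -> f u = 0.

Lemma deg_sum e u : deg e u = (\sum_v e u v)%N.
Proof.
rewrite /deg -sum1_card big_mkcond /=; apply: eq_bigr => v _.
by rewrite inE; case: (e u v).
Qed.

Lemma lap_laplacian e f u : irreflexive e ->
  lap e f u = \sum_v laplacian R e u v * f v.
Proof.
move=> irr; rewrite /lap; under eq_bigr do rewrite mulrBr.
rewrite sumrB -mulr_suml -natr_sum -deg_sum [RHS](bigD1 u) //= /laplacian eqxx.
congr (_ + _); rewrite (bigD1 u) //= irr mul0r add0r -sumrN.
apply: eq_bigr => v vu; rewrite eq_sym (negbTE vu).
by case: (e u v); rewrite ?mul1r ?mulN1r ?mul0r ?oppr0.
Qed.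

Lemma laplacian_sym e u v : symmetric e -> laplacian R e u v = laplacian R e v u.
Proof. by move=> se; rewrite /laplacian eq_sym se; case: eqP => // ->. Qed.

Lemma sum_supported e f (g : 'I_n -> R) : supported e f ->
  \sum_(i < #|interior e|) f (enum_val i) * g (enum_val i) = \sum_u f u * g u.
Proof.
move=> sf; rewrite -(big_enum_val (fun u => f u * g u)) /= [RHS](bigID (mem (interior e))) /=.
by rewrite [X in _ + X]big1 ?addr0 // => u /sf ->; rewrite mul0r.
Qed.

Definition row_of e f : 'rV[R]_#|interior e| := \row_i f (enum_val i).

Lemma row_of_dirichlet e f j : simple_graph e -> supported e f ->
  (row_of e f *m dirichlet R e) 0 j = lap e f (enum_val j).
Proof.
move=> [se irr] sf; rewrite mxE lap_laplacian //.
under eq_bigr do rewrite !mxE laplacian_sym // mulrC.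
under [RHS]eq_bigr do rewrite mulrC.
under eq_bigr do rewrite mulrC.
by rewrite (sum_supported (fun v => laplacian R e (enum_val j) v) sf).
Qed.

Lemma row_of_energy e f : simple_graph e -> supported e f ->
  (row_of e f *m dirichlet R e *m (row_of e f)^T) 0 0 = energy e f.
Proof.
move=> ge sf; rewrite mxE.
under eq_bigr do rewrite row_of_dirichlet // !mxE mulrC.
exact: sum_supported.
Qed.

Lemma row_of_sqnorm e f : supported e f ->
  (row_of e f *m (row_of e f)^T) 0 0 = sqnorm f.
Proof.
move=> sf; rewrite mxE; under eq_bigr do rewrite !mxE.
by rewrite (sum_supported f sf); apply: eq_bigr => u _; rewrite expr2.
Qed.

Lemma row_ofP e (x : 'rV[R]_#|interior e|) :
  exists2 f, supported e f & row_of e f = x.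
Proof.
(* The sum has at most one term, as [enum_val] is injective, and is empty outside the interior: this
   is the extension of [x] by zero. *)
exists (fun u => \sum_(i | enum_val i == u) x 0 i) => [u uI|].
  by rewrite big1 // => i /eqP iu; rewrite -iu enum_valP in uI.
apply/rowP => j; rewrite mxE (bigD1 j) //= big1 ?addr0 // => i /andP[/eqP ij].
by rewrite (enum_val_inj ij) eqxx.
Qed.

Lemma eigenfunction e l : simple_graph e -> eigenvalue (dirichlet R e) l ->
  exists f, [/\ supported e f, exists u, f u != 0 &
                {in interior e, forall u, lap e f u = l * f u}].
Proof.
move=> ge /eigenvalueP[x xl x0]; have [f sf fx] := row_ofP x.
exists f; split=> // [|u uI].
  have /rV0Pn[j xj] := x0; exists (enum_val j).
  by move: xj; rewrite -fx mxE.
rewrite -(enum_rankK_in uI uI) -row_of_dirichlet //.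
by rewrite fx xl -fx !mxE.
Qed.

Lemma energy_eigen e f l : supported e f ->
  {in interior e, forall u, lap e f u = l * f u} -> energy e f = l * sqnorm f.
Proof.
move=> sf fl; rewrite mulr_sumr; apply: eq_bigr => u _.
have [uI|uI] := boolP (u \in interior e); first by rewrite fl // mulrCA expr2.
by rewrite sf // expr0n /= mulr0 mul0r.
Qed.

Lemma sqnorm_gt0 f u : f u != 0 -> 0 < sqnorm f.
Proof.
move=> fu; rewrite /sqnorm (bigD1 u) //= ltr_pwDl ?lt_def ?sqr_ge0 ?sqrf_eq0 ?fu //.
by rewrite sumr_ge0 // => v _; rewrite sqr_ge0.
Qed.

Lemma rayleigh_eigenvalue e : simple_graph e -> interior e != set0 ->
  exists l, smallest_eigenvalue (dirichlet R e) l /\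
    forall f, supported e f -> l * sqnorm f <= energy e f.
Proof.
move=> ge I0; have [||l [el le]] := @symmetric_min_eigenvalue R _ (dirichlet R e).
- by rewrite card_gt0.
- by apply/matrixP => i j; rewrite !mxE laplacian_sym //; case: ge.
exists l; have ray f : supported e f -> l * sqnorm f <= energy e f.
  by move=> sf; rewrite -(row_of_sqnorm sf) -(row_of_energy ge sf).
split=> //; split=> // mu /eigenfunction[//|f [sf [u fu] fmu]].
by have := ray f sf; rewrite (energy_eigen sf fmu) ler_pM2r // (sqnorm_gt0 fu).
Qed.

Lemma rayleigh_le e l f : simple_graph e -> interior e != set0 ->
  smallest_eigenvalue (dirichlet R e) l -> supported e f ->
  l * sqnorm f <= energy e f.
Proof.
move=> ge I0 [el le] sf; have [l' [[el' le'] ray]] := rayleigh_eigenvalue ge I0.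
have -> : l = l' by apply/eqP; rewrite eq_le le // le'.
exact: ray.
Qed.

Lemma lap_sym e f g : symmetric e -> \sum_u g u * lap e f u = \sum_u f u * lap e g u.
Proof.
move=> se.
have E (h k : 'I_n -> R) : \sum_u h u * lap e k u =
    \sum_u h u * k u * (deg e u)%:R - \sum_u \sum_v (e u v)%:R * (h u * k v).
  rewrite -sumrB; apply: eq_bigr => u _; rewrite deg_sum natr_sum !mulr_sumr -sumrB.
  by apply: eq_bigr => v _; ring.
rewrite !E; congr (_ - _); first by apply: eq_bigr => u _; rewrite [g u * _]mulrC.
rewrite exchange_big; apply: eq_bigr => u _; apply: eq_bigr => v _.
by rewrite se [g v * _]mulrC.
Qed.

Lemma energyD e f g t : symmetric e ->
  energy e (fun u => f u + t * g u) =
  energy e f + 2 * t * (\sum_u g u * lap e f u) + t ^+ 2 * energy e g.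
Proof.
move=> se; have lapD u : lap e (fun u => f u + t * g u) u = lap e f u + t * lap e g u.
  by rewrite /lap mulr_sumr -big_split; apply: eq_bigr => v _ /=; ring.
rewrite /energy -{1}[2]/(1 + 1) !mulrDl mul1r -{2}(lap_sym g f se) !mulr_sumr -!big_split.
by apply: eq_bigr => u _ /=; rewrite lapD; ring.
Qed.

Lemma quadratic_ge0_lin0 (b c : R) : (forall t, 0 <= 2 * t * b + t ^+ 2 * c) -> b = 0.
Proof.
move=> h; apply/eqP/contraT => b0.
(* Since [c < 2 d], the value at [t = - b / d], namely [(b / d)^2 (c - 2 d)], is negative as soon as
   [b] is nonzero. *)
pose d := `|c| + 1; have d0 : 0 < d by rewrite ltr_wpDl.
have cd : c <= d by rewrite (le_trans (ler_norm c)) // lerDl.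
have := h (- b / d).
have -> : 2 * (- b / d) * b + (- b / d) ^+ 2 * c = (b / d) ^+ 2 * (c - 2 * d).
  by field; rewrite gt_eqF.
rewrite pmulr_rge0; last by rewrite lt_def sqr_ge0 sqrf_eq0 mulf_neq0 // invr_eq0 gt_eqF.
lra.
Qed.

(** First variation: adding to [f] a multiple [t] of the indicator of an interior vertex gives a
    nonnegative quadratic in [t], whose linear coefficient is the defect of the eigenvalue equation
    at that vertex. *)
Lemma minimizer_eigenfunction e f l : simple_graph e ->
  (forall g, supported e g -> l * sqnorm g <= energy e g) ->
  supported e f -> energy e f <= l * sqnorm f ->
  {in interior e, forall u, lap e f u = l * f u}.
Proof.
move=> [se irr] ray sf ef u uI; apply/eqP; rewrite -subr_eq0; apply/eqP.
pose g v : R := (v == u)%:R.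
have gE (h : 'I_n -> R) : \sum_v g v * h v = h u.
  rewrite (bigD1 u) //= /g eqxx mul1r big1 ?addr0 // => v /negbTE ->.
  by rewrite mul0r.
apply: (@quadratic_ge0_lin0 _ (energy e g - l * sqnorm g)) => t.
have /ray : supported e (fun v => f v + t * g v).
  move=> v vI; rewrite sf // /g; case: eqP vI => [->|]; first by rewrite uI.
  by rewrite mulr0 addr0.
rewrite energyD // gE.
have -> : sqnorm (fun v => f v + t * g v) = sqnorm f + 2 * t * f u + t ^+ 2 * sqnorm g.
  rewrite -(gE f) /sqnorm !mulr_sumr -!big_split /=; apply: eq_bigr => v _; ring.
lra.
Qed.

Lemma energy_abs e f : energy e (fun u => `|f u|) <= energy e f.
Proof.
apply: ler_sum => u _; rewrite !mulr_sumr; apply: ler_sum => v _.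
rewrite !(mulrCA _ (e u v)%:R) ler_wpM2l // !mulrBr -!normrM.
by rewrite -expr2 ger0_norm ?sqr_ge0 // lerB // ler_norm.
Qed.

(** Taking absolute values does not raise the energy, so [|f|] is again a minimizer and an
    eigenfunction. At an interior zero its Laplacian is minus a sum of nonnegative terms and equals
    [0], so all neighbours vanish too; by connectedness [f] would be zero. *)
Lemma positive_eigenfunction e l : simple_graph e -> connected e ->
  interior e != set0 -> smallest_eigenvalue (dirichlet R e) l ->
  exists f, [/\ supported e f, {in interior e, forall u, 0 < f u} &
                energy e f = l * sqnorm f].
Proof.
move=> ge ce I0 le; have [f [sf [u0 fu0] fl]] := eigenfunction ge le.1.
pose g u := `|f u|.
have sg : supported e g by move=> u /sf; rewrite /g => ->; rewrite normr0.
have ray h : supported e h -> l * sqnorm h <= energy e h by apply: rayleigh_le.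
have nfg : sqnorm g = sqnorm f.
  by apply: eq_bigr => u _; rewrite real_normK ?num_real.
have gl : {in interior e, forall u, lap e g u = l * g u}.
  apply: minimizer_eigenfunction => //.
  by rewrite nfg -(energy_eigen sf fl) energy_abs.
exists g; split=> // [u uI|]; last exact: energy_eigen.
rewrite lt_def normr_ge0 andbT; apply: contra_neqN fu0 => /eqP gu0.
suff : g u0 = 0 by move/eqP; rewrite normr_eq0 => /eqP.
have nbr0 v : v \in interior e -> g v = 0 -> forall y, e v y -> g y = 0.
  move=> /gl + gv0 y vy; rewrite gv0 mulr0 /lap.
  under eq_bigr do rewrite gv0 sub0r mulrN.
  rewrite sumrN => /eqP; rewrite oppr_eq0 psumr_eq0 => [/allP/(_ y)|z _].
    by rewrite mem_index_enum vy mul1r => /(_ isT)/eqP.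
  by rewrite mulr_ge0 // normr_ge0.
(* A walk can leave a boundary vertex only towards its single neighbour, so the
   zero set is propagated together with the neighbours of its boundary points. *)
suff prop p v : path e v p -> g v = 0 /\ (forall y, e v y -> g y = 0) -> g (last v p) = 0.
  by have /connectP[p pp ->] := ce u u0; apply: prop => //; split=> //; apply: nbr0.
elim: p v => [|y p IH] v /=; first by move=> _ [].
move=> /andP[vy yp] [gv gN]; apply: IH => //; split; first exact: gN.
have [yI|] := boolP (y \in interior e); first by apply: nbr0 => //; apply: gN.
rewrite inE -leqNgt => dy z yz; suff -> : z = v by [].
move/card_le1_eqP: dy; apply; rewrite inE //; by case: ge => ->.
Qed.

End Energy.

(** * Rooted trees: heights, parents, ancestors *)

Section Trees.
Local Open Scope nat_scope.
Variable n : nat.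
Implicit Types (e : rel 'I_n) (u v w r : 'I_n).

Lemma nball_path e u p : path e u p -> last u p \in nball e (size p) u.
Proof.
elim/last_ind: p => [|p w IH] /=; first by rewrite inE.
rewrite rcons_path last_rcons size_rcons /= => /andP[/IH up pw].
by rewrite inE; apply/orP; right; rewrite inE; apply/existsP; exists (last u p); rewrite up.
Qed.

Lemma dist_spec e u v : connected e ->
  v \in nball e (dist e u v) u /\
  (forall k, v \in nball e k u -> dist e u v <= k).
Proof.
move=> ce; have hasv : has (fun k => v \in nball e k u) (iota 0 n).
  have /connectP[p0 pp0 ->] := ce u v; case/shortenP: pp0 => p pp up _.
  (* A simple path has fewer than [n] edges, so the search in [iota 0 n] succeeds and [find] does
     not return its default [n]. *)
  apply/hasP; exists (size p); last exact: nball_path.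
  rewrite mem_iota /= add0n; have := max_card (mem (u :: p)).
  by rewrite (card_uniqP up) card_ord.
split.
  by have := nth_find 0 hasv; rewrite nth_iota // -[X in _ < X](size_iota 0) -has_find.
move=> k vk; rewrite leqNgt; apply/negP => kd.
have := before_find 0 kd; rewrite nth_iota ?add0n ?vk // (ltn_trans kd) //.
by rewrite -[X in _ < X](size_iota 0) -has_find.
Qed.

Lemma dist_root e r : 0 < n -> dist e r r = 0.
Proof. by rewrite /dist; case: n e r => // m e r _ /=; rewrite inE eqxx. Qed.

Lemma dist_eq0 e r v : connected e -> dist e r v = 0 -> v = r.
Proof.
by move=> ce d0; have [+ _] := dist_spec r v ce; rewrite d0 inE => /eqP.
Qed.

Lemma dist_pred e r v : connected e -> v != r ->
  exists u, e u v && (dist e r v == (dist e r u).+1).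
Proof.
move=> ce vr; have [] := dist_spec r v ce.
case dv : (dist e r v) => [|k]; first by rewrite (dist_eq0 ce dv) eqxx in vr.
rewrite /= inE => /orP[vk /(_ _ vk)|]; first by rewrite ltnn.
rewrite inE => /existsP[u /andP[uk uv]] vmin.
exists u; rewrite uv /= eqSS eqn_leq; apply/andP; split.
  have [ud _] := dist_spec r u ce.
  suff /vmin : v \in nball e (dist e r u).+1 r by [].
  by rewrite /= inE; apply/orP; right; rewrite inE; apply/existsP; exists u; rewrite ud.
by have [_] := dist_spec r u ce; apply.
Qed.

(** No vertex qualifies when [v] is the root, which has height [0], so the default makes the root
    its own parent. *)
Definition parent e r v : 'I_n :=
  odflt r [pick u | e u v && (dist e r v == (dist e r u).+1)].

Section Rooted.
Variables (e : rel 'I_n) (r : 'I_n).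
Hypothesis te : is_tree e.
Local Notation p := (parent e r).
Local Notation h := (dist e r).

Let ce : connected e. Proof. by case: te. Qed.
Let se : symmetric e. Proof. by case: te => [[]]. Qed.
Let irr : irreflexive e. Proof. by case: te => [[]]. Qed.

Lemma parentP v : v != r -> e (p v) v /\ h v = (h (p v)).+1.
Proof.
move=> vr; rewrite /parent; case: pickP => [u /andP[uv /eqP]|] //= no.
by have [u] := dist_pred ce vr; rewrite no.
Qed.

Lemma parent_edge v : v != r -> e (p v) v. Proof. by case/parentP. Qed.
Lemma height_parent v : v != r -> h v = (h (p v)).+1. Proof. by case/parentP. Qed.
Lemma height_root : h r = 0. Proof. by rewrite dist_root //; case: n r => // -[]. Qed.
Lemma height_gt0 v : (0 < h v) = (v != r).
Proof.
have [->|vr] := eqVneq v r; first by rewrite height_root.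
by rewrite height_parent.
Qed.

(* The n - 1 parent edges are pairwise distinct, hence exhaust all edges. *)
Lemma edge_parent u v : e u v -> (v != r) && (u == p v) || (u != r) && (v == p u).
Proof.
pose E := [set q : 'I_n * 'I_n | e q.1 q.2 && (q.1 < q.2)].
pose F v := if p v < v then (p v, v) else (v, p v).
have Finj : {in [set~ r] &, injective F}.
  move=> x y; rewrite !inE => xr yr; rewrite /F.
  have := height_parent xr; have := height_parent yr.
  by case: ifP => _; case: ifP => _ hx hy [] // a b; have := congr1 h a; have := congr1 h b; lia.
have FE : F @: [set~ r] = E.
  apply/eqP; rewrite eqEcard card_in_imset // cardsC1 card_ord; apply/andP; split.
    apply/subsetP => q /imsetP[x xr ->{q}]; move: xr; rewrite !inE /F => xr.
    have px := parent_edge xr; case: ltnP => /= [lt|ge]; first by rewrite px lt.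
    by rewrite se px /= ltn_neqAle ge andbT; apply/eqP => /val_inj xp; rewrite -xp irr in px.
  by case: te => _ _ <-.
have main x y : e x y -> x < y -> (y != r) && (x == p y) || (x != r) && (y == p x).
  move=> xy lt; have : (x, y) \in E by rewrite inE xy lt.
  rewrite -FE => /imsetP[z]; rewrite !inE /F => zr.
  by case: ifP => _ [-> ->]; rewrite zr eqxx ?orbT.
move=> uv; case: (ltngtP u v) => [|vu|/val_inj uv']; first exact: main.
  by rewrite orbC main // se.
by rewrite uv' irr in uv.
Qed.

Lemma edgeE u v : e u v = (v != r) && (u == p v) || (u != r) && (v == p u).
Proof.
apply/idP/idP; first exact: edge_parent.
by move=> /orP[] /andP[ur /eqP ->]; rewrite ?parent_edge // se parent_edge.
Qed.

Lemma childE v w : child e r v w = (w != r) && (v == p w).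
Proof.
rewrite /child edgeE; have [->|wr] := eqVneq w r.
  by rewrite height_root andbF.
rewrite (height_parent wr); case: eqP => [->|_] /=; first by rewrite eqxx.
apply/negbTE/negP => /andP[/andP[vr /eqP wp]] /eqP.
have := height_parent vr; have := height_parent wr; rewrite -wp; lia.
Qed.

Definition children v : {set 'I_n} := [set w | (w != r) && (v == p w)].

Lemma deg_children v : deg e v = #|children v| + (v != r).
Proof.
rewrite /deg; have [->|vr] := eqVneq v r.
  rewrite addn0; apply: eq_card => w; rewrite !inE edgeE eqxx.
  by rewrite orbF.
have -> : [set w | e v w] = p v |: children v.
  by apply/setP => w; rewrite !inE edgeE vr orbC.
rewrite cardsU1 addnC; congr (_ + _); rewrite inE; apply/eqP; rewrite eqb1.
apply/negP => /andP[pr /eqP vp]; have := height_parent vr; have := height_parent pr.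
rewrite -vp; lia.
Qed.

(* [anc a w] relies on truncated subtraction: for [h a > h w] it reads [w == a]. *)
Definition anc a w := iter (h w - h a) p w == a.

Lemma anc_refl a : anc a a. Proof. by rewrite /anc subnn. Qed.

Lemma anc_height a w : anc a w -> h a <= h w.
Proof.
rewrite /anc leqNgt => /eqP aw; apply/negP => lt_wa.
have e0 : h w - h a = 0 by lia.
by rewrite e0 /= in aw; rewrite aw ltnn in lt_wa.
Qed.

Lemma anc_eqh a w : anc a w -> h a = h w -> a = w.
Proof. by rewrite /anc => /eqP aw hh; rewrite hh subnn in aw. Qed.

Lemma anc_parentl a w : w != r -> anc a (p w) -> anc a w.
Proof.
move=> wr aw; have le := anc_height aw; move: aw.
by rewrite /anc (height_parent wr) subSn // iterSr.
Qed.

Lemma ancE a w : w != r -> anc a w = (a == w) || anc a (p w).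
Proof.
move=> wr; have [->|aw] := eqVneq a w; first by rewrite anc_refl.
apply/idP/idP => /= [a_w|]; last exact: anc_parentl.
have := anc_height a_w; rewrite leq_eqVlt => /orP[/eqP /(anc_eqh a_w) /eqP|].
  by rewrite (negbTE aw).
by move: a_w; rewrite /anc (height_parent wr) ltnS => + le; rewrite subSn // iterSr.
Qed.

Lemma anc_root a : anc a r -> a = r.
Proof. by rewrite /anc height_root sub0n /= => /eqP. Qed.

Lemma height_ind (P : 'I_n -> Prop) : P r ->
  (forall v, v != r -> P (p v) -> P v) -> forall v, P v.
Proof.
move=> Pr Pp v; move: {2}(h v) (erefl (h v)) => k; elim: k v => [|k IH] v hv.
  by rewrite (dist_eq0 ce hv).
have vr : v != r by rewrite -height_gt0 hv.
by apply: Pp => //; apply: IH; move: hv; rewrite height_parent // => -[].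
Qed.

Lemma anc_trans b a c : anc a b -> anc b c -> anc a c.
Proof.
move=> ab; elim/height_ind: c => [/anc_root br|c cr IH]; first by rewrite -br.
by rewrite (ancE b) // => /orP[/eqP <- //|/IH]; apply: anc_parentl.
Qed.

Lemma anc_child_uniq x y v w : x \in children v -> y \in children v ->
  anc x w -> anc y w -> x = y.
Proof.
rewrite !inE => /andP[xr /eqP xv] /andP[yr /eqP yv] /eqP xw /eqP yw.
by rewrite -xw -yw (height_parent xr) (height_parent yr) -xv -yv.
Qed.

Lemma connect_root (S : {set 'I_n}) v : (forall a, anc a v -> a \notin S) ->
  connect [rel x y | e x y && (x \notin S) && (y \notin S)] v r.
Proof.
elim/height_ind: v => [//|v vr IH] vS.
have [pS vS'] : p v \notin S /\ v \notin S.
  split; apply: vS; last exact: anc_refl.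
  by apply: anc_parentl => //; apply: anc_refl.
apply: (connect_trans (y := p v)).
  by apply: connect1; rewrite /= se parent_edge // pS vS'.
by apply: IH => a av; apply: vS; apply: anc_parentl.
Qed.

(** Both vertices climb to the root through their ancestors, all of which avoid [S]. *)
Lemma connect_off (S : {set 'I_n}) v w :
  (forall a, anc a v -> a \notin S) -> (forall a, anc a w -> a \notin S) ->
  connect [rel x y | e x y && (x \notin S) && (y \notin S)] v w.
Proof.
move=> vS wS; apply: connect_trans (connect_root vS) _.
rewrite sym_connect_sym; first exact: connect_root.
by move=> x y /=; rewrite se andbAC.
Qed.

Lemma child_not_anc x v : x \in children v -> ~~ anc x v.
Proof.
rewrite inE => /andP[xr /eqP ->]; apply/negP => /anc_height.
by rewrite (height_parent xr) ltnn.
Qed.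

Lemma height_child x v : x \in children v -> h x = (h v).+1.
Proof. by rewrite inE => /andP[xr /eqP ->]; apply: height_parent. Qed.

End Rooted.

Lemma handshake e : simple_graph e -> \sum_u deg e u = 2 * nedges e.
Proof.
move=> [se irr]; under eq_bigr do rewrite deg_sum.
rewrite /nedges -sum1_card.
rewrite (eq_bigl (fun q : 'I_n * 'I_n => e q.1 q.2 && (q.1 < q.2))) => [|q]; last by rewrite inE.
rewrite [X in 2 * X]big_mkcond -(pair_bigA _ (fun x y => if e x y && (x < y) then 1 else 0)) /=.
rewrite mul2n -addnn [X in _ = _ + X]exchange_big /= -big_split; apply: eq_bigr => u _ /=.
rewrite -big_split; apply: eq_bigr => v _ /=; rewrite (se v u).
by case: ltngtP => [||/val_inj ->]; rewrite ?irr //; case: (e u v).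
Qed.

End Trees.

Section Class.
Local Open Scope nat_scope.
Variable n : nat.
Implicit Types (e : rel 'I_n).

(** The edge count of a tree carries over because, by the handshake identity, it is half the degree
    sum, which permuting the degrees preserves. *)
Lemma same_class_perm e e' (s : {perm 'I_n}) : tree_with_boundary e ->
  simple_graph e' -> connected e' -> (forall x, deg e' x = deg e (s x)) ->
  same_class e e'.
Proof.
move=> [[ge ce ne] /set0Pn[b bb] /set0Pn[i ii]] ge' ce' ds; split; last first.
  rewrite /degseq (eq_map ds) (map_comp (deg e) s); apply: perm_map.
  apply: uniq_perm; [|exact: enum_uniq|].
    by rewrite (map_inj_uniq (@perm_inj _ s)) enum_uniq.
  by move=> x; rewrite mem_enum; apply/mapP; exists (s^-1%g x); rewrite ?mem_enum // permKV.
split; last first.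
- by apply/set0Pn; exists (s^-1%g i); rewrite inE ds permKV; rewrite inE in ii.
- by apply/set0Pn; exists (s^-1%g b); rewrite inE ds permKV; rewrite inE in bb.
split=> //; rewrite -ne; apply/eqP; rewrite -(eqn_pmul2l (isT : 0 < 2)) -!handshake //.
by rewrite [eqbRHS](reindex_inj (@perm_inj _ s)) (eq_bigr _ (fun x _ => ds x)).
Qed.

End Class.

(** * Redirecting edges between two vertices, and the effect on degrees and energy *)

Section Exchange.
Variables (R : realType) (n : nat).
Implicit Types (f g : 'I_n -> R) (u v w x y : 'I_n).

(* Every edge joining a vertex of [S] to [v] (resp. [w]) is redirected to [w]
   (resp. [v]). *)
Definition exchange (e : rel 'I_n) v w (S : {set 'I_n}) : rel 'I_n := fun x y =>
  if x \in S then e x (tperm v w y)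
  else if y \in S then e (tperm v w x) y else e x y.

Lemma exchangeC e v w S : exchange e v w S = exchange e w v S.
Proof. by rewrite /exchange tpermC. Qed.

Variables (e : rel 'I_n) (v w : 'I_n) (S : {set 'I_n}).
Hypotheses (ge : simple_graph e) (vw : v != w) (vS : v \notin S) (wS : w \notin S).
Local Notation e' := (exchange e v w S).
Local Notation t := (tperm v w).

Let tS x : x \in S -> t x = x.
Proof.
by move=> xS; rewrite tpermD //; [apply: contraNneq vS|apply: contraNneq wS] => ->.
Qed.

Lemma exchange_simple : simple_graph e'.
Proof.
have [se irr] := ge; split=> [x y|x]; rewrite /exchange.
  by case: ifP => xS; case: ifP => yS; rewrite se // (tS xS) (tS yS).
by have [/tS ->|_] := boolP (x \in S); rewrite irr.
Qed.

(** The ends [v] and [w] remain joined by a path avoiding [S], which the exchange leaves intact. An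
    edge lost by the exchange has one end in [S] and the other in [v] or [w], and the end in [S] is
    attached to the other of these two instead. *)
Lemma exchange_connected : connected e ->
  connect [rel x y | e x y && (x \notin S) && (y \notin S)] v w -> connected e'.
Proof.
move=> ce vwS; have [se' _] := exchange_simple.
have cvw : connect e' v w.
  apply: connect_sub vwS => x y /= /andP[/andP[xy xS] yS]; apply: connect1.
  by rewrite /exchange (negbTE xS) (negbTE yS).
have cs : connect_sym e' by apply: sym_connect_sym.
have prop q : forall x, path e x q -> last x q = v -> connect e' x v.
  elim: q => [x _ <- //|y q IH x /= /andP[xy yq] qv].
  have cy := IH y yq qv.
  have [xy'|nxy] := boolP (e' x y); first exact: connect_trans (connect1 xy') cy.
  have hv z : z = v \/ z = w -> connect e' z v.
    by case=> -> //; rewrite cs.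
  move: nxy; rewrite /exchange; case: ifP => xS.
    case: (tpermP v w y) => [yv|yw|_ _]; rewrite ?xy //.
      move=> _; apply: connect_trans (_ : connect e' w v); last by rewrite cs.
      by apply: connect1; rewrite /exchange xS tpermR -yv.
    by move=> _; apply: connect1; rewrite /exchange xS tpermL -yw.
  case: ifP => yS; last by rewrite xy.
  by case: (tpermP v w x) => [->|->|]; rewrite ?xy // => *; apply: hv; auto.
move=> x y; have reach z : connect e' z v.
  by have /connectP[q zq vq] := ce z v; apply: prop zq _.
by apply: connect_trans (reach x) _; rewrite cs.
Qed.

Lemma exchange_sum_mem x (g : 'I_n -> R) : x \in S ->
  \sum_y (e' x y)%:R * g y = \sum_y (e x y)%:R * g (t y).
Proof.
move=> xS; rewrite (reindex_inj (@perm_inj _ t)); apply: eq_bigr => y _.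
by rewrite /exchange xS tpermK.
Qed.

Lemma exchange_sum_end (g : 'I_n -> R) :
  \sum_y (e' v y)%:R * g y = \sum_y (e v y)%:R * g y +
    \sum_(y in S) ((e w y)%:R - (e v y)%:R) * g y.
Proof.
rewrite [X in _ = _ + X]big_mkcond -big_split; apply: eq_bigr => y _ /=.
rewrite /exchange (negbTE vS) tpermL; case: ifP => _; last by rewrite addr0.
by rewrite -mulrDl addrC subrK.
Qed.

Lemma exchange_sum_other x (g : 'I_n -> R) : x \notin S -> x != v -> x != w ->
  \sum_y (e' x y)%:R * g y = \sum_y (e x y)%:R * g y.
Proof.
move=> xS xv xw; apply: eq_bigr => y _; rewrite /exchange (negbTE xS).
by rewrite tpermD 1?eq_sym //; case: ifP.
Qed.

Lemma degR (d : rel 'I_n) x : (deg d x)%:R = \sum_y (d x y)%:R * 1 :> R.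
Proof. by rewrite deg_sum natr_sum; apply: eq_bigr => y _; rewrite mulr1. Qed.

Lemma exchange_deg_other x : x != v -> x != w -> deg e' x = deg e x.
Proof.
move=> xv xw; apply/eqP; rewrite -(eqr_nat R) !degR.
have [xS|xS] := boolP (x \in S); first by rewrite exchange_sum_mem.
by rewrite exchange_sum_other.
Qed.

Lemma exchange_deg_end : (deg e' v)%:R = (deg e v)%:R +
  \sum_(y in S) ((e w y)%:R - (e v y)%:R) :> R.
Proof.
by rewrite !degR exchange_sum_end; congr (_ + _); apply: eq_bigr => y _; rewrite mulr1.
Qed.

Lemma exchange_lap_end f : lap e' f v = lap e f v +
  \sum_(y in S) ((e w y)%:R - (e v y)%:R) * (f v - f y).
Proof. exact: exchange_sum_end. Qed.

Lemma exchange_lap_mem f x : x \in S -> lap e' f x = lap e f x +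
  ((e x v)%:R - (e x w)%:R) * (f v - f w).
Proof.
move=> xS; rewrite /lap exchange_sum_mem // (bigD1 v) //= (bigD1 w) 1?eq_sym //=.
rewrite [X in _ = X + _](bigD1 v) //= [X in _ = _ + X + _](bigD1 w) 1?eq_sym //=.
rewrite tpermL tpermR.
rewrite (eq_bigr (fun y => (e x y)%:R * (f x - f y))) => [|y /andP[yv yw]]; first by ring.
by rewrite tpermD // eq_sym.
Qed.

End Exchange.

Section ExchangeEnergy.
Variables (R : realType) (n : nat).
Variables (e : rel 'I_n) (v w : 'I_n) (S : {set 'I_n}).
Hypotheses (ge : simple_graph e) (vw : v != w) (vS : v \notin S) (wS : w \notin S).
Local Notation e' := (exchange e v w S).

(** Replacing an edge from [x] to [w] by one from [x] to [v] changes the energy by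
    [(f v - f x)^2 - (f w - f x)^2], which factors as shown; the opposite replacement changes the
    sign. *)
Lemma exchange_energy (f : 'I_n -> R) : energy e' f = energy e f +
  \sum_(x in S) ((e x w)%:R - (e x v)%:R) * ((f v - f w) * (f v + f w - 2 * f x)).
Proof.
have [se _] := ge.
have dv := exchange_lap_end e (S := S) w vS f.
have dw := exchange_lap_end e (S := S) v wS f; rewrite exchangeC in dw.
rewrite /energy [LHS](bigD1 v) //= [X in _ + X](bigD1 w) 1?eq_sym //=.
rewrite [X in _ = X + _](bigD1 v) //= [X in _ = _ + X + _](bigD1 w) 1?eq_sym //=.
have -> : \sum_(x | (x != v) && (x != w)) f x * lap e' f x =
    \sum_(x | (x != v) && (x != w)) f x * lap e f x +
    \sum_(x in S) f x * (((e x v)%:R - (e x w)%:R) * (f v - f w)).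
  rewrite [X in _ = _ + X](eq_bigl (fun x => ((x != v) && (x != w)) && (x \in S))); last first.
    move=> x; have [xS|] := boolP (x \in S); last by rewrite andbF.
    by rewrite andbT; apply/esym/andP; split; [apply: contraNneq vS|apply: contraNneq wS] => <-.
  rewrite [X in _ = _ + X]big_mkcondr -big_split; apply: eq_bigr => x /andP[xv xw] /=.
  case: ifP => xS; first by rewrite exchange_lap_mem // mulrDr.
  by rewrite addr0 /lap exchange_sum_other ?xS.
rewrite dv dw !mulrDr !mulr_sumr.
set a := \sum_(i in S) _; set b := \sum_(i in S) _; set c := \sum_(i in S) _.
set d := \sum_(i in S) _.
suff : a + b + c = d by move=> <-; ring.
rewrite -!big_split; apply: eq_bigr => x _ /=.
by rewrite (se x v) (se x w); ring.
Qed.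

End ExchangeEnergy.

(** * Ground states of trees with minimal eigenvalue in their class *)

Section Minimizer.
Variables (R : realType) (n : nat) (e : rel 'I_n) (l : R) (f : 'I_n -> R).
Hypothesis tb : tree_with_boundary e.
Hypothesis sf : supported e f.
Hypothesis fpos : {in interior e, forall u, 0 < f u}.
Hypothesis ef : energy e f = l * sqnorm f.
Hypothesis ray : forall (e' : rel 'I_n) (g : 'I_n -> R),
  same_class e e' -> supported e' g -> l * sqnorm g <= energy e' g.
Implicit Types (u v w x y z a : 'I_n).

Let te : is_tree e. Proof. by case: tb. Qed.
Let ge : simple_graph e. Proof. by case: te. Qed.
Let ce : connected e. Proof. by case: te. Qed.

Lemma f_gt0 u : (0 < f u) = (u \in interior e).
Proof.
by apply/idP/idP => [|/fpos //]; apply: contraTT => /sf ->; rewrite ltxx.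
Qed.

Lemma f_ge0 u : 0 <= f u.
Proof. by have [/fpos/ltW //|/sf ->] := boolP (u \in interior e). Qed.

Lemma class_energy_le (e' : rel 'I_n) : same_class e e' -> interior e' = interior e ->
  energy e f <= energy e' f.
Proof. by move=> cl ie; rewrite ef; apply: ray => // u; rewrite ie => /sf. Qed.

(** With no larger energy on [e'], [f] attains the lower bound [l] there as well, so it solves the
    eigenvalue equation of both trees with the same [l]. *)
Lemma class_stationary (e' : rel 'I_n) : same_class e e' -> interior e' = interior e ->
  energy e' f <= energy e f -> {in interior e, lap e' f =1 lap e f}.
Proof.
move=> cl ie le u ui.
rewrite (@minimizer_eigenfunction R n e f l) ?ef //; last first.
  by move=> g; apply: ray; split.
rewrite (@minimizer_eigenfunction R n e' f l) ?ie // -?ef //.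
- by case: cl => -[[]].
- by move=> g; apply: ray.
- by move=> w; rewrite ie => /sf.
Qed.

(** * Monotonicity of the ground state away from a root where it is maximal *)

Variable r : 'I_n.
Hypothesis rmax : forall u, f u <= f r.
Local Notation p := (parent e r).
Local Notation h := (dist e r).
Local Notation children := (children e r).
Local Notation anc := (anc e r).

Lemma root_interior : r \in interior e.
Proof.
have [_ _ /set0Pn[i /fpos i0]] := tb.
by rewrite -f_gt0 (lt_le_trans i0).
Qed.

Lemma parent_interior x : x != r -> p x \in interior e.
Proof.
move=> xr; have [->|pr] := eqVneq (p x) r; first exact: root_interior.
rewrite inE (deg_children r te) pr addn1 ltnS card_gt0; apply/set0Pn.
by exists x; rewrite inE xr eqxx.
Qed.

Lemma mem_children x : x != r -> x \in children (p x).
Proof. by rewrite inE eqxx => ->. Qed.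

Lemma childrenP x v : x \in children v -> x != r /\ v = p x.
Proof. by rewrite inE => /andP[-> /eqP]. Qed.

Lemma child_interior x v : x \in children v -> v \in interior e.
Proof. by case/childrenP => xr ->; apply: parent_interior. Qed.

Lemma has_child v : v \in interior e -> exists x, x \in children v.
Proof.
rewrite inE (deg_children r te) => dv; apply/set0Pn; rewrite -card_gt0.
by rewrite -(ltn_add2r (v != r)); apply: leq_ltn_trans dv; case: (v != r).
Qed.

(** The root is interior, so it has at least two children, and at most one of them can be an
    ancestor of [a]. *)
Lemma root_child_avoiding a : exists2 y, y \in children r & ~~ anc y a.
Proof.
have [y /andP[yr ya]|no] := pickP [pred y | (y \in children r) && ~~ anc y a].
  by exists y.
have := root_interior; rewrite inE (deg_children r te) eqxx addn0 ltnNge.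
case/negP; apply/card_le1_eqP => x y xr yr.
have ax := no x; have ay := no y; rewrite /= in ax ay.
rewrite xr /= in ax; rewrite yr /= in ay.
by apply/esym/(anc_child_uniq te xr yr (w := a)); apply/negbFE.
Qed.

Lemma not_adjacent x v w : x \in children v -> v != w -> ~~ anc x w -> e w x = false.
Proof.
move=> /childrenP[xr vx] vw xw; apply/negbTE/negP; rewrite (edgeE r te).
case/orP => [/andP[_ /eqP wx]|/andP[wr /eqP xp]]; first by rewrite vx -wx eqxx in vw.
by case/negP: xw; rewrite (ancE te) // xp anc_refl orbT.
Qed.

(** Exchanging the children [u1] and [u2] keeps all degrees, and the ancestor conditions keep the
    graph connected. The energy changes by [2 (f v1 - f v2) (f u1 - f u2)], which is therefore
    nonnegative. If it is zero, the Laplacians of both trees agree: at [v1] this yields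
    [f u1 = f u2] when [f v1 = f v2], and at [u1], if interior, it yields [f v1 = f v2]. *)
Lemma switch v1 u1 v2 u2 : v1 != v2 -> u1 \in children v1 -> u2 \in children v2 ->
  ~~ anc u1 v2 -> ~~ anc u2 v1 ->
  (f v1 = f v2 -> f u1 = f u2) /\
  (f v2 < f v1 -> f u2 < f u1 \/ f u1 = 0 /\ f u2 = 0).
Proof.
move=> v12 c1 c2 a1 a2.
have i1 := child_interior c1; have i2 := child_interior c2.
have [u1r v1E] := childrenP c1; have [u2r v2E] := childrenP c2.
have [se irr] := ge.
have e11 : e v1 u1 by rewrite v1E parent_edge.
have e22 : e v2 u2 by rewrite v2E parent_edge.
have e21 : e v2 u1 = false by apply: not_adjacent c1 _ a1.
have e12 : e v1 u2 = false by apply: not_adjacent c2 _ a2; rewrite eq_sym.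
have u12 : u1 != u2 by apply: contraNneq v12 => u12; rewrite v1E v2E u12.
pose S := [set u1; u2].
have v1S : v1 \notin S.
  rewrite !inE negb_or; apply/andP; split; apply/eqP => E.
    by rewrite -E irr in e11.
  by rewrite -E anc_refl in a2.
have v2S : v2 \notin S.
  rewrite !inE negb_or; apply/andP; split; apply/eqP => E.
    by rewrite -E anc_refl in a1.
  by rewrite -E irr in e22.
have sumS (F : 'I_n -> R) : \sum_(y in S) F y = F u1 + F u2.
  by rewrite big_setU1 ?inE // big_set1.
pose e' := exchange e v1 v2 S.
have ge' : simple_graph e' by apply: exchange_simple.
have conn : connect [rel x y | e x y && (x \notin S) && (y \notin S)] v1 v2.
  apply: (connect_off te (r := r)) => a av.
    rewrite !inE negb_or; apply/andP; split; apply/eqP => aE; rewrite aE in av.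
      by rewrite (negbTE (child_not_anc te c1)) in av.
    by rewrite av in a2.
  rewrite !inE negb_or; apply/andP; split; apply/eqP => aE; rewrite aE in av.
    by rewrite av in a1.
  by rewrite (negbTE (child_not_anc te c2)) in av.
have degE x : deg e' x = deg e x.
  have [->|xv1] := eqVneq x v1.
    apply/eqP; rewrite -(eqr_nat R) exchange_deg_end // sumS e11 e12 e21 e22.
    by rewrite sub0r subr0 addNr addr0.
  have [->|xv2] := eqVneq x v2.
    apply/eqP; rewrite -(eqr_nat R) /e' exchangeC exchange_deg_end // sumS e11 e12 e21 e22.
    by rewrite sub0r subr0 addrN addr0.
  exact: exchange_deg_other.
have cl : same_class e e'.
  apply: (same_class_perm (s := 1%g)) => // [|x]; last by rewrite perm1.
  exact: exchange_connected.
have ie : interior e' = interior e by apply/setP => x; rewrite !inE degE.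
have dE : energy e' f - energy e f = 2 * ((f v1 - f v2) * (f u1 - f u2)).
  rewrite exchange_energy // sumS !(se u1) !(se u2) e11 e12 e21 e22 /=; ring.
have d0 : 0 <= (f v1 - f v2) * (f u1 - f u2).
  by have := class_energy_le cl ie; rewrite -subr_ge0 dE pmulr_rge0.
have eq0 : (f v1 - f v2) * (f u1 - f u2) = 0 -> {in interior e, lap e' f =1 lap e f}.
  by move=> E; apply: class_stationary => //; rewrite -subr_le0 dE E mulr0.
split=> [E|lt].
  have := eq0 _ v1 i1; rewrite E subrr mul0r exchange_lap_end // sumS e11 e12 e21 e22 /=.
  by move=> /(_ erefl); lra.
have := d0; rewrite pmulr_rge0 ?subr_gt0 // subr_ge0 le_eqVlt => /orP[/eqP E|]; last by left.
right; suff u1b : u1 \notin interior e by rewrite E (sf u1b).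
apply/negP => u1i; have := eq0 _ u1 u1i; rewrite E subrr mulr0 exchange_lap_mem ?inE ?eqxx //.
by rewrite !(se u1) e11 e21 /= => /(_ erefl); lra.
Qed.

Lemma child_lt x : x != r -> f (p x) < f r -> f x < f (p x).
Proof.
move=> xr lt; set a := p x in lt *.
have ar : a != r by apply: contraTneq lt => ->; rewrite ltxx.
(* [Y] gathers the root and the vertices in branches at the root not containing [a], with value
   above [f a]. A highest such [y] has a child [y'] off the path to [a] with [f y' <= f a];
   switching [y'] with [x] then bounds [f x]. *)
pose Y := [pred y | (f a < f y) && [forall z, (z != r) ==> ~~ (anc z a && anc z y)]].
have Yr : Y r.
  rewrite /= lt; apply/forallP => z; apply/implyP => zr; rewrite negb_and.
  by apply/orP; right; apply: contraNN zr => /anc_root ->.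
have [y /andP[ay /forallP yanc] ymax] := arg_maxnP h Yr.
have [y' yy' y'a] : exists2 y', y' \in children y & ~~ anc y' a.
  have [->|yr] := eqVneq y r; first exact: root_child_avoiding.
  have [|y' yy'] := @has_child y; first by rewrite -f_gt0 (le_lt_trans (f_ge0 a)).
  exists y' => //; apply: contraTN (yanc y) => y'a; rewrite yr anc_refl andbT negbK.
  apply: (anc_trans te) y'a; have [y'r ->] := childrenP yy'.
  by apply: (anc_parentl te) => //; apply: anc_refl.
have [y'r yE] := childrenP yy'.
have le : f y' <= f a.
  rewrite leNgt; apply/negP => lt'; have /ymax : Y y'.
    rewrite /= lt'; apply/forallP => z; apply/implyP => zr.
    apply/negP => /andP[za]; rewrite (ancE te) // => /orP[/eqP zy'|].
      by rewrite -zy' za in y'a.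
    by rewrite -yE => zy; have := yanc z; rewrite zr za zy.
  by rewrite (height_child te yy') /= ltnn.
have [|||||_ /(_ ay)[/lt_le_trans/(_ le) //|[_ ->]]] := @switch y y' a x.
- by apply: contraTneq ay => ->; rewrite ltxx.
- by [].
- exact: mem_children.
- by [].
- apply/negP => xy; have := yanc a; rewrite ar anc_refl /= => /negP; apply.
  apply: (anc_trans te) xy; apply: (anc_parentl te) => //; exact: anc_refl.
by rewrite f_gt0 parent_interior.
Qed.

Lemma child_le x : x != r -> f x <= f (p x).
Proof.
move=> xr; have [/(child_lt xr)/ltW //|] := ltP (f (p x)) (f r).
exact: le_trans.
Qed.

Lemma child_eq x : x != r -> f x = f (p x) -> f x = f r.
Proof.
move=> xr E; have [/(child_lt xr)|] := ltP (f (p x)) (f r); first by rewrite E ltxx.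
by rewrite -E => le; apply/eqP; rewrite eq_le rmax.
Qed.

Lemma anc_le a x : anc a x -> f x <= f a.
Proof.
elim/(height_ind te (r := r)): x => [/anc_root -> //|x xr IH].
rewrite (ancE te) // => /orP[/eqP -> //|/IH]; exact: le_trans (child_le xr).
Qed.

(** Given two such children, take a vertex [y] of maximal height among the non-root maxima outside
    the branch of [x]. Switching a child of [y] with [x] shows that this child is a maximum as well,
    one level further from the root. *)
Lemma max_child_uniq x z : x \in children r -> z \in children r ->
  f x = f r -> f z = f r -> x = z.
Proof.
move=> xr zr fx fz; apply/eqP/contraT => xz.
have [x0 xE] := childrenP xr; have [z0 zE] := childrenP zr.
pose Y := [pred y | [&& f y == f r, y != r & ~~ anc x y]].
have Yz : Y z.
  rewrite /= fz eqxx z0; apply/negP => /(anc_eqh (e := e)) E; case/eqP: xz; apply: E.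
  by rewrite (height_child te xr) (height_child te zr).
have [y /and3P[/eqP fy yr xy] ymax] := arg_maxnP h Yz.
have [|y' yy'] := @has_child y; first by rewrite -f_gt0 fy f_gt0 root_interior.
have [y'r yE] := childrenP yy'.
have [||+ _] := @switch y y' r x yr yy' xr.
- by apply/negP => /anc_root E; rewrite E eqxx in y'r.
- by [].
move=> /(_ fy); rewrite fx => fy'; have /ymax : Y y'.
  rewrite /= fy' eqxx y'r (ancE te) // negb_or -yE xy andbT.
  by apply: contraNneq yr => E; rewrite yE -E -xE.
by rewrite (height_child te yy') /= ltnn.
Qed.

(** Otherwise [p x] is a maximal child of the root by induction. Switching [x] with a root child [y]
    that is not an ancestor of [p x] makes [y] a second maximal child. *)
Lemma max_parent x : x != r -> f x = f r -> p x = r.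
Proof.
elim/(height_ind te (r := r)): x => [|x _ IH xr fx]; first by rewrite eqxx.
apply/eqP/contraT => zr; have fz : f (p x) = f r.
  by apply/eqP; rewrite eq_le rmax -fx child_le.
have pz := IH zr fz; have [y yr ya] := root_child_avoiding (p x).
have [|||||/(_ (esym fz)) + _] := @switch r y (p x) x.
- by rewrite eq_sym.
- by [].
- exact: mem_children.
- by [].
- by apply/negP => /anc_root/eqP; rewrite (negbTE xr).
rewrite fx => fy; case/negP: ya; rewrite (max_child_uniq yr _ fy fz) ?anc_refl //.
by rewrite inE zr pz eqxx.
Qed.

(** By induction the parents are ordered by [f]; switching transfers this to [v] and [w], unless [w]
    is an ancestor of [v], where values decrease along the path. *)
Lemma height_lt_le v w : (h w < h v)%N -> f v <= f w.
Proof.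
elim/(height_ind te (r := r)): w v => [v _|w wr IH v]; first exact: rmax.
move=> wv; have vr : v != r by rewrite -(height_gt0 r te) (leq_ltn_trans _ wv).
have hp : (h (p w) < h (p v))%N.
  by move: wv; rewrite (height_parent te wr) (height_parent te vr).
have le := IH _ hp.
have [/anc_le wa|wpv] := boolP (anc w (p v)); first exact: le_trans (child_le vr) wa.
have [|||||eqw ltw] := @switch (p w) w (p v) v.
- by apply: contraTneq hp => ->; rewrite ltnn.
- exact: mem_children.
- exact: mem_children.
- by [].
- apply/negP => /(@anc_height _ e r); have := height_parent te wr; lia.
move: le; rewrite le_eqVlt => /orP[/eqP /esym/eqw -> //|/ltw[/ltW //|[-> ->//]]].
Qed.

(** Moving [S] from [v] to [w] swaps their two degrees, so the class is kept, and the energy does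
    not increase. Stationarity at [v] then makes the sum of the [f v - f x] over [S] vanish,
    although every term is positive. *)
Lemma shift v w (S : {set 'I_n}) : v != w -> v \in interior e -> w \in interior e ->
  S \subset children v -> {in S, forall x, ~~ anc x w} ->
  (#|S| + deg e w = deg e v)%N -> S != set0 ->
  f w <= f v -> {in S, forall x, f x < f v} -> {in S, forall x, f x <= f w} -> False.
Proof.
move=> vw vi wi /subsetP Sc Sa cS /set0Pn[x0 x0S] lwv lt le.
have [se irr] := ge.
have ev x : x \in S -> e v x by move=> /Sc /childrenP[xr ->]; rewrite parent_edge.
have ew x : x \in S -> e w x = false.
  by move=> xS; apply: not_adjacent (Sc _ xS) vw (Sa _ xS).
have vS : v \notin S by apply/negP => /ev; rewrite irr.
have wS : w \notin S by apply/negP => /Sa; rewrite anc_refl.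
pose e' := exchange e v w S.
have ge' : simple_graph e' by apply: exchange_simple.
have conn : connect [rel x y | e x y && (x \notin S) && (y \notin S)] v w.
  apply: (connect_off te (r := r)) => a av.
    by apply/negP => /Sc/(child_not_anc te); rewrite av.
  by apply/negP => /Sa; rewrite av.
have sumS (c : R) (F : 'I_n -> R) : (forall x, x \in S -> F x = c) ->
    \sum_(y in S) F y = c * #|S|%:R.
  by move=> Fc; rewrite (eq_bigr _ Fc) sumr_const mulr_natr.
have dv : deg e' v = deg e w.
  apply/eqP; rewrite -(eqr_nat R) exchange_deg_end // (sumS (- 1)) => [|x xS].
    by rewrite -cS natrD mulN1r; apply/eqP; ring.
  by rewrite ev // ew // sub0r.
have dw : deg e' w = deg e v.
  apply/eqP; rewrite -(eqr_nat R) /e' exchangeC exchange_deg_end // (sumS 1) => [|x xS].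
    by rewrite -cS natrD mul1r addrC.
  by rewrite ev // ew // subr0.
have degE x : deg e' x = deg e (tperm v w x).
  case: tpermP => [->|->|/eqP xv /eqP xw] //; exact: exchange_deg_other.
have cl : same_class e e'.
  by apply: (same_class_perm (s := tperm v w)) => //; apply: exchange_connected.
have ie : interior e' = interior e.
  apply/setP => x; rewrite !inE in vi wi *; rewrite degE.
  by case: tpermP => [->|->|//]; rewrite vi wi.
have /(_ v vi) : {in interior e, lap e' f =1 lap e f}.
  apply: class_stationary => //; rewrite exchange_energy // gerDl.
  apply: sumr_le0 => x xS; rewrite !(se x) ev // ew // sub0r mulN1r oppr_le0.
  by rewrite mulr_ge0 ?subr_ge0 // mulr_natl mulr2n lerD // ?le // ltW ?lt.
rewrite exchange_lap_end // => /eqP; rewrite -subr_eq0 addrAC subrr add0r.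
rewrite (eq_bigr (fun y => - (f v - f y))) => [|y yS]; last by rewrite ev // ew // sub0r mulN1r.
rewrite sumrN oppr_eq0 psumr_eq0 => [/allP/(_ x0)|y yS]; last by rewrite subr_ge0 ltW ?lt.
by rewrite mem_index_enum x0S subr_eq0 => /(_ isT) /eqP E; have := lt _ x0S; rewrite E ltxx.
Qed.

(** If [deg e w < deg e v], a set of [deg e v - deg e w] children of [v] is moved to [w]. Absence of
    values strictly between [f w] and [f v] turns [f x < f v] into [f x <= f w], as [shift]
    requires. *)
Lemma degree_step v w : v \in interior e -> w \in interior e -> f w <= f v ->
  (forall u, f w < f u -> f v <= f u) -> (deg e v <= deg e w)%N.
Proof.
move=> vi wi lwv gap; rewrite leqNgt; apply/negP => dwv.
have vw : v != w by apply: contraTneq dwv => ->; rewrite ltnn.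
pose A := [set x in children v | anc x w].
pose B := [set x in children v | f v <= f x].
pose C := [set x in children v | ~~ anc x w & f x < f v].
have cA : (#|A| <= 1)%N.
  apply/card_le1_eqP => y x; rewrite inE => /andP[yv yw]; rewrite inE => /andP[xv xw].
  exact: anc_child_uniq xv yv xw yw.
have BP x : x \in B -> [/\ x \in children v, v = r & f x = f r].
  rewrite inE => /andP[xv le]; have [xr vE] := childrenP xv.
  have fx : f x = f r by apply: child_eq => //; apply/eqP; rewrite eq_le child_le // -vE.
  by split=> //; rewrite vE max_parent.
have cB : (#|B| <= (v == r))%N.
  have [vr|/eqP vr] := eqVneq v r; last first.
    by rewrite leqn0 cards_eq0; apply/eqP/setP => x; rewrite [RHS]inE; apply/negP => /BP[].
  apply/card_le1_eqP => y x /BP[yv _ fy] /BP[xv _ fx]; rewrite vr in xv yv.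
  exact: max_child_uniq.
(* Excluded from [C] are at most one child above [w] and, only when [v] is the root, at most one
   child of maximal value. A non-root [v] instead loses its parent edge, so [2] suffices in both
   cases, and [deg e w >= 2] absorbs it. *)
have cC : (deg e v <= #|C| + 2)%N.
  have : (#|children v| <= #|A :|: B :|: C|)%N.
    apply: subset_leq_card; apply/subsetP => x xv; rewrite !inE; rewrite inE in xv.
    by rewrite xv /=; case: (anc x w) => //=; case: ltP => //=; rewrite ?orbT.
  have := (leq_card_setU (A :|: B) C).1; have := (leq_card_setU A B).1.
  rewrite (deg_children r te); move: cA cB; case: (v == r) => /=.
    move: #|A :|: B :|: C| #|A :|: B| #|A| #|B| #|C| #|children v|; lia.
  move: #|A :|: B :|: C| #|A :|: B| #|A| #|B| #|C| #|children v|; lia.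
pose k := (deg e v - deg e w)%N.
have w2 : (2 <= deg e w)%N by rewrite inE in wi.
have kC : (k <= #|C|)%N by rewrite /k; lia.
pose S := [set x in take k (enum C)].
have SC x : x \in S -> x \in C by rewrite inE => /mem_take; rewrite mem_enum.
have cS : #|S| = k.
  rewrite cardsE (card_uniqP _) ?take_uniq ?enum_uniq // size_takel // -cardE //.
apply: (@shift v w S) => //.
- by apply/subsetP => x /SC; rewrite inE => /andP[].
- by move=> x /SC; rewrite inE => /and3P[].
- by rewrite cS subnK // ltnW.
- by rewrite -card_gt0 cS subn_gt0.
- by move=> x /SC; rewrite inE => /and3P[].
move=> x /SC; rewrite inE => /and3P[_ _ xv]; rewrite leNgt; apply/negP => /gap.
by rewrite leNgt xv.
Qed.

(** Induction on the number of vertices with value strictly between [f w] and [f v]: any such vertex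
    is interior and splits the comparison. *)
Lemma degree_le v w : v \in interior e -> w \in interior e -> f w <= f v ->
  (deg e v <= deg e w)%N.
Proof.
pose N v w := #|[set u | f w < f u < f v]|.
move: {2}(N v w).+1 (ltnSn (N v w)) => k; elim: k v w => // k IH v w Nk vi wi le.
have [u /andP[wu uv]|no] := pickP [pred u | f w < f u < f v]; last first.
  apply: degree_step => // u wu; rewrite leNgt; apply/negP => uv.
  by have := no u; rewrite /= wu uv.
have ui : u \in interior e by rewrite -f_gt0 (le_lt_trans (f_ge0 w)).
have lt1 : (N v u < N v w)%N.
  apply: proper_card; apply/properP; split.
    by apply/subsetP => x; rewrite !inE => /andP[/(lt_trans wu) -> ->].
  by exists u; rewrite !inE ?wu ?uv // ltxx.
have lt2 : (N u w < N v w)%N.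
  apply: proper_card; apply/properP; split.
    by apply/subsetP => x; rewrite !inE => /andP[-> /lt_trans ->].
  by exists u; rewrite !inE ?wu ?uv // ltxx andbF.
apply: (leq_trans (IH v u _ vi ui (ltW uv))); first exact: leq_trans lt1 _.
by apply: IH => //; [exact: leq_trans lt2 _|exact: ltW].
Qed.

(** Larger values of [f] give smaller digits; adding the index breaks ties. *)
Definition digit v : nat := (#|[set u | (f v < f u)%R]| * n + v)%N.

(* Base-[n * n] numeral listing the digits met from the root down to [v]: it compares
   heights first, then parents, then the values of [f], then indices. *)
Fixpoint key_fuel k v : nat :=
  if k is k'.+1 then (key_fuel k' (p v) * (n * n) + digit v)%N else 1%N.
Definition key v := key_fuel (h v) v.

Lemma key_root : key r = 1%N. Proof. by rewrite /key height_root. Qed.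

Lemma keyS v : v != r -> key v = (key (p v) * (n * n) + digit v)%N.
Proof. by move=> vr; rewrite {1}/key (height_parent te vr). Qed.

Lemma digit_lt v : (digit v < n * n)%N.
Proof.
have lt : (#|[set u | (f v < f u)%R]| < n)%N.
  rewrite -[X in (_ < X)%N]card_ord -cardsT; apply: proper_card; apply/properP; split.
    exact: subsetT.
  by exists v; rewrite !inE // ltxx.
by have := ltn_ord v; rewrite /digit; nia.
Qed.

Lemma key_gt0 v : (0 < key v)%N.
Proof.
elim/(height_ind te (r := r)): v => [|v vr IH]; first by rewrite key_root.
by rewrite keyS //; have := ltn_ord v; nia.
Qed.

Lemma key_parent v w : v != r -> w != r -> (key (p v) < key (p w))%N -> (key v < key w)%N.
Proof. by move=> vr wr; rewrite (keyS vr) (keyS wr); have := digit_lt v; nia. Qed.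

(** The leading digit [1] of every key makes a longer numeral larger. *)
Lemma key_height v w : (h v < h w)%N -> (key v < key w)%N.
Proof.
elim/(height_ind te (r := r)): v w => [w|v vr IH w] lt.
  have wr : w != r by rewrite -(height_gt0 r te) (leq_ltn_trans _ lt).
  rewrite key_root keyS //; have := key_gt0 (p w); have := ltn_ord w.
  have n2 : (1 < n)%N.
    by have := ltn_ord w; case: (n) (w) (r) wr => [|[|//]] // w' r'; rewrite !ord1 eqxx.
  nia.
have wr : w != r by rewrite -(height_gt0 r te) (leq_ltn_trans _ lt).
apply: key_parent => //; apply: IH.
by move: lt; rewrite (height_parent te vr) (height_parent te wr).
Qed.

Lemma key_inj : injective key.
Proof.
move=> v w; have nr x : x != r -> key r != key x.
  by move=> xr; rewrite ltn_eqF // key_height // height_root (height_gt0 r te).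
have [->|vr] := eqVneq v r.
  by have [->//|/nr/eqP] := eqVneq w r.
have [->|wr] := eqVneq w r; first by move/esym/eqP; rewrite (negbTE (nr _ vr)).
have dE x : x != r -> digit x = (key x %% (n * n))%N.
  by move=> xr; rewrite (keyS xr) modnMDl modn_small // digit_lt.
have vE x : val x = (digit x %% n)%N by rewrite /digit modnMDl modn_small.
by move=> E; apply: val_inj; rewrite (vE v) (vE w) (dE v vr) (dE w wr) E.
Qed.

(** The order by height, parent and value refines the decreasing order of [f]. For equal heights and
    distinct parents, [switch] forces the parents to be strictly ordered by [f] in the same way, and
    induction applies to them. *)
Lemma key_value v w : f w < f v -> (key v < key w)%N.
Proof.
elim/(height_ind te (r := r)): w v => [v|w wr IH v lt]; first by rewrite ltNge rmax.
have [hvw|hwv|hvw] := ltngtP (h v) (h w); first exact: key_height.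
  by have := height_lt_le hwv; rewrite leNgt lt.
have vr : v != r by rewrite -(height_gt0 r te) hvw (height_gt0 r te).
have [E|pvw] := eqVneq (p v) (p w).
  rewrite (keyS vr) (keyS wr) E ltn_add2l /digit.
  have : (#|[set u | (f v < f u)%R]| < #|[set u | (f w < f u)%R]|)%N.
    apply: proper_card; apply/properP; split.
      by apply/subsetP => u; rewrite !inE; apply: lt_trans.
    by exists v; rewrite !inE // ltxx.
  by have := ltn_ord v; nia.
apply: key_parent => //; apply: IH.
have hp : h (p v) = h (p w).
  by move: hvw; rewrite (height_parent te vr) (height_parent te wr) => -[].
have [|||||eqw ltw] := @switch (p w) w (p v) v.
- by rewrite eq_sym.
- exact: mem_children.
- exact: mem_children.
- by apply/negP => /(@anc_height _ e r); have := height_parent te wr; lia.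
- by apply/negP => /(@anc_height _ e r); have := height_parent te vr; lia.
case: (ltgtP (f (p w)) (f (p v))) => // [/ltw[lt'|[w0 v0]]|/eqw E].
- by have := lt_trans lt lt'; rewrite ltxx.
- by rewrite w0 v0 ltxx in lt.
- by rewrite E ltxx in lt.
Qed.

End Minimizer.

Lemma rank_perm n (K : 'I_n -> nat) : injective K ->
  exists rk : {perm 'I_n}, forall u v, (rk u < rk v)%N = (K u < K v)%N.
Proof.
move=> Kinj; pose c v := #|[set u | (K u < K v)%N]|.
have c_lt u v : (K u < K v)%N -> (c u < c v)%N.
  move=> uv; apply: proper_card; apply/properP; split.
    by apply/subsetP => x; rewrite !inE => /ltn_trans ->.
  by exists u; rewrite !inE // ltnn.
have cn v : (c v < n)%N.
  rewrite -[X in (_ < X)%N]card_ord -cardsT; apply: proper_card; apply/properP; split.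
    exact: subsetT.
  by exists v; rewrite !inE // ltnn.
have cE u v : (c u < c v)%N = (K u < K v)%N.
  apply/idP/idP => [|/c_lt //]; case: (ltngtP (K u) (K v)) => // [/c_lt|/Kinj ->].
    lia.
  by rewrite ltnn.
have inj : injective (fun v => Ordinal (cn v)).
  move=> u v /(congr1 val) /= E; apply: Kinj; apply/eqP.
  by have := cE u v; have := cE v u; rewrite E ltnn; case: ltngtP.
by exists (perm inj) => u v; rewrite !permE /= cE.
Qed.

Lemma ground_state_SLO_star (R : realType) n (e : rel 'I_n) (l : R) (f : 'I_n -> R) :
  tree_with_boundary e -> supported e f -> {in interior e, forall u, 0 < f u} ->
  energy e f = l * sqnorm f ->
  (forall (e' : rel 'I_n) (g : 'I_n -> R), same_class e e' -> supported e' g ->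
     l * sqnorm g <= energy e' g) ->
  SLO_star_tree e.
Proof.
move=> tb sf fpos ef ray; split=> //; have [te _ /set0Pn[i0 _]] := tb.
have [r _ rmax'] := @arg_maxP _ R 'I_n i0 predT f isT.
have rmax u : f u <= f r by apply: rmax'.
have [rk rkE] := rank_perm (@key_inj _ _ _ f tb r).
exists r, rk; split; last first.
  move=> v w vi wi; rewrite rkE => lt; apply: (degree_le tb sf fpos ef ray rmax) => //.
  by rewrite leNgt; apply/negP => /(key_value tb sf fpos ef ray rmax); lia.
split=> [v w|v1 v2 c1 c2|v w]; rewrite rkE => lt.
- by rewrite leqNgt; apply/negP => /(key_height f tb); lia.
- rewrite rkE !(childE r te) => /andP[c1r /eqP E1] /andP[c2r /eqP E2].
  by apply: (key_parent tb) => //; rewrite -E1 -E2.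
(* For (S3): [f] vanishes at the boundary vertex [v], hence also at the later [w], which therefore
   is not interior; its degree is positive, so it is [1]. *)
rewrite !inE => /eqP dv; have v0 : f v = 0 by apply: sf; rewrite inE dv.
have : f w <= f v by rewrite leNgt; apply/negP => /(key_value tb sf fpos ef ray rmax); lia.
rewrite v0 leNgt (f_gt0 sf fpos) inE -leqNgt => dw; rewrite eqn_leq dw /=.
have := root_interior tb sf fpos rmax; rewrite inE => dr.
rewrite (deg_children r te); have [E|_] := eqVneq w r; first by rewrite E in dw; lia.
lia.
Qed.

(** * Reconstruction of an SLO*-tree from its degree sequence *)

Section Uniqueness.
Local Open Scope nat_scope.

Lemma tree_deg_gt0 n (e : rel 'I_n) v : tree_with_boundary e -> 0 < deg e v.
Proof.
move=> [te _ /set0Pn[r]]; rewrite inE => dr.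
have [->|vr] := eqVneq v r; first exact: ltnW.
by rewrite (deg_children r te) vr addn1.
Qed.

(* The order of degrees along an SLO*-ordering: interior degrees increase and the
   leaves come last. *)
Definition leaf_last (a b : nat) := (b == 1) || ((a != 1) && (a <= b)).

(** Listed by rank, the degrees of each tree are sorted for the same order [leaf_last], and the two
    lists are permutations of each other, hence equal. *)
Lemma SLO_star_degrees n (G H : rel 'I_n) vG vH (rG rH : {perm 'I_n}) :
  tree_with_boundary G -> tree_with_boundary H -> SLO_star G vG rG -> SLO_star H vH rH ->
  perm_eq (degseq H) (degseq G) ->
  forall i, deg G (rG^-1%g i) = deg H (rH^-1%g i).
Proof.
move=> tG tH oG oH HG.
pose s (e : rel 'I_n) (rk : {perm 'I_n}) := [seq deg e (rk^-1%g i) | i <- enum 'I_n].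
have s_perm e rk : perm_eq (s e rk) (degseq e).
  rewrite /s (map_comp (deg e)); apply: perm_map; apply: uniq_perm.
  - by rewrite (map_inj_uniq (@perm_inj _ _)) enum_uniq.
  - exact: enum_uniq.
  by move=> x; rewrite mem_enum; apply/mapP; exists (rk x); rewrite ?mem_enum // permK.
have s_sorted e r rk : tree_with_boundary e -> SLO_star e r rk -> sorted leaf_last (s e rk).
  move=> te [[_ _ S3] S4]; apply: (homo_sorted (e := fun i j : 'I_n => i < j)).
    move=> i j ij; set u := (rk^-1)%g i; set v := (rk^-1)%g j.
    have uv : rk u < rk v by rewrite !permKV.
    have pos x := tree_deg_gt0 x te.
    rewrite /leaf_last; have [//|dv] := eqVneq (deg e v) 1.
    have du : deg e u != 1.
      by apply: contraNneq dv => du; have := S3 _ _ uv; rewrite !inE du; apply.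
    rewrite du /=; apply: S4 uv; rewrite inE.
      by have := pos u; case: (deg e u) du => [|[]].
    by have := pos v; case: (deg e v) dv => [|[]].
  have := iota_ltn_sorted 0 n; rewrite -val_enum_ord sorted_map.
  by apply: sub_sorted.
have sE : s G rG = s H rH.
  apply: (sorted_eq (leT := leaf_last)).
  - by move=> b a c; rewrite /leaf_last; case: (eqVneq c 1) => //=; case: (eqVneq b 1); lia.
  - by move=> a b; rewrite /leaf_last; case: (eqVneq b 1); case: (eqVneq a 1); lia.
  - exact: s_sorted oG.
  - exact: s_sorted oH.
  by rewrite (perm_trans (s_perm _ _)) // perm_sym (perm_trans (s_perm _ _)).
by move=> i; move/eq_in_map: sE; apply; rewrite mem_enum.
Qed.

(** At a first disagreement, say [P j < Q j], monotonicity puts the fiber of [Q] over [P j] among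
    the indices below [j], where both maps agree; the fiber of [P] contains [j] in addition. Index
    [0] is left out since it will be the rank of the root. *)
Lemma monotone_fibers n (P Q : 'I_n -> 'I_n) :
  (forall i j : 'I_n, 0 < i -> i <= j -> P i <= P j) ->
  (forall i j : 'I_n, 0 < i -> i <= j -> Q i <= Q j) ->
  (forall k, #|[set j : 'I_n | (0 < j) && (P j == k)]| =
             #|[set j : 'I_n | (0 < j) && (Q j == k)]|) ->
  forall j : 'I_n, 0 < j -> P j = Q j.
Proof.
move=> mP mQ fE j; move: {2}(val j) (erefl (val j)) => m; elim/ltn_ind: m j => m IH j jm j0.
have step (P' Q' : 'I_n -> 'I_n) :
    (forall i k : 'I_n, 0 < i -> i <= k -> Q' i <= Q' k) ->
    (forall i : 'I_n, i < j -> 0 < i -> P' i = Q' i) -> P' j < Q' j ->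
    #|[set i : 'I_n | (0 < i) && (Q' i == P' j)]| < #|[set i : 'I_n | (0 < i) && (P' i == P' j)]|.
  move=> mQ' E lt; apply: proper_card; apply/properP; split; last first.
    by exists j; rewrite !inE ?j0 ?eqxx //= -val_eqE /= gtn_eqF.
  apply/subsetP => i; rewrite !inE => /andP[i0 /eqP Qi]; rewrite i0 /=.
  have [ij|ji] := ltnP i j; first by rewrite E // Qi.
  by have := mQ' _ _ j0 ji; rewrite Qi leqNgt lt.
have IHj (i : 'I_n) : i < j -> 0 < i -> P i = Q i by move=> ij; apply: (IH i) => //; rewrite -jm.
have [lt|gt|/val_inj //] := ltngtP (P j) (Q j).
- by have := step P Q mQ IHj lt; rewrite fE ltnn.
- by have := step Q P mP (fun i a b => esym (IHj i a b)) gt; rewrite fE ltnn.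
Qed.

Section SLOStructure.
Variables (n : nat) (e : rel 'I_n) (r : 'I_n) (rk : {perm 'I_n}).
Hypotheses (te : is_tree e) (oe : SLO e r rk).
Definition parent_rank (j : 'I_n) : 'I_n := rk (parent e r (rk^-1%g j)).

Lemma SLO_root v : (0 < rk v) = (v != r).
Proof.
have [S1 _ _] := oe; have min u : rk u < rk r -> u = r.
  move/S1; rewrite (height_root e r) leqn0 => /eqP; apply: dist_eq0.
  by case: te.
have n0 : 0 < n := leq_ltn_trans (leq0n _) (ltn_ord r).
have rk0 : rk r = 0 :> nat.
  apply/eqP/contraT; rewrite -lt0n => lt.
  have E : (rk^-1)%g (Ordinal n0) = r by apply: min; rewrite permKV.
  by move: lt; rewrite -E permKV.
have [->|] := eqVneq v r; first by rewrite rk0.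
by apply: contraNT; rewrite -eqn0Ngt -rk0 => /eqP /val_inj/perm_inj ->.
Qed.

Lemma SLO_edge u v : e u v = (0 < rk v) && (rk u == parent_rank (rk v)) ||
  (0 < rk u) && (rk v == parent_rank (rk u)).
Proof. by rewrite (edgeE r te) !SLO_root /parent_rank !permK !(inj_eq perm_inj). Qed.

Lemma SLO_parent_mono (i j : 'I_n) : 0 < i -> i <= j -> parent_rank i <= parent_rank j.
Proof.
have [_ S2 _] := oe; rewrite -{1 2}(permKV rk i) -{1}(permKV rk j) => i0 ij.
have j0 := leq_trans i0 ij; rewrite SLO_root in i0; rewrite SLO_root in j0.
rewrite leqNgt; apply/negP => lt; move: ij; rewrite leqNgt => /negP; apply.
by apply: S2 lt _ _; rewrite (childE r te) ?i0 ?j0 eqxx.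
Qed.

Lemma SLO_fiber (k : 'I_n) : #|[set j : 'I_n | (0 < j) && (parent_rank j == k)]| =
  deg e (rk^-1%g k) - (0 < k).
Proof.
have k0 : (0 < k) = ((rk^-1)%g k != r) by rewrite -SLO_root permKV.
rewrite (deg_children r te) k0 addnK -(card_imset _ (@perm_inj _ rk)).
apply: eq_card => j; rewrite inE; apply/idP/imsetP => [/andP[j0 /eqP jk]|[x]].
  exists ((rk^-1)%g j); rewrite ?permKV // inE -SLO_root permKV j0 /=.
  by rewrite -jk permK.
rewrite inE => /andP[xr /eqP kx] ->; rewrite SLO_root xr /= /parent_rank permK -kx.
by rewrite permKV.
Qed.

End SLOStructure.

(** The isomorphism matches vertices of equal rank. Degrees by rank agree, so the monotone parent
    maps have fibers of equal size and coincide. *)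
Lemma SLO_star_unique n (G H : rel 'I_n) : SLO_star_tree G -> SLO_star_tree H ->
  perm_eq (degseq H) (degseq G) -> isomorphic G H.
Proof.
move=> [tbG [vG [rG oG]]] [tbH [vH [rH oH]]] HG.
have degE := SLO_star_degrees tbG tbH oG oH HG.
have [tG _ _] := tbG; have [tH _ _] := tbH; have [sG _] := oG; have [sH _] := oH.
have PE := monotone_fibers (SLO_parent_mono tG sG) (SLO_parent_mono tH sH).
exists (rG * rH^-1)%g => u v.
rewrite (SLO_edge tG sG) (SLO_edge tH sH) !permM !permKV.
have {}PE : forall j : 'I_n, 0 < j -> parent_rank G vG rG j = parent_rank H vH rH j.
  by apply: PE => k; rewrite (SLO_fiber tG sG) (SLO_fiber tH sH) degE.
by case: (posnP (rG u)) => [|/PE ->]; case: (posnP (rG v)) => [|/PE ->].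
Qed.

End Uniqueness.

(** * Existence of a minimizer and the two implications *)

Section FaberKrahn.
Variables (R : realType) (n : nat).
Implicit Types (e G H : rel 'I_n).

Lemma faber_krahn_SLO_star e : tree_with_boundary e -> faber_krahn R e -> SLO_star_tree e.
Proof.
move=> tb [l [le lmin]]; have [[ge ce _] _ I0] := tb.
have [f [sf fpos ef]] := positive_eigenfunction ge ce I0 le.
apply: (ground_state_SLO_star tb sf fpos ef) => e' g cl sg.
have [[[ge' _ _] _ I0'] _] := cl; have [l' [le' ray']] := rayleigh_eigenvalue R ge' I0'.
apply: le_trans (ray' g sg); apply: ler_wpM2r; last exact: lmin cl le'.
by apply: sumr_ge0 => u _; apply: sqr_ge0.
Qed.

Lemma exists_minimizer G : tree_with_boundary G -> exists H (l : R),
  [/\ same_class G H, smallest_eigenvalue (dirichlet R H) l &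
    forall e (l' : R), same_class G e -> smallest_eigenvalue (dirichlet R e) l' -> l <= l'].
Proof.
(* Relations are encoded as sets of pairs, which form a finite type on which a minimum exists;
   outside the class the chosen eigenvalue is a dummy [0]. *)
move=> tb; pose rel_of (E : {set 'I_n * 'I_n}) : rel 'I_n := fun x y => (x, y) \in E.
have rel_ofK e : rel_of [set q | e q.1 q.2] = e.
  by apply/funext => x; apply/funext => y; rewrite /rel_of inE.
have /choice[lam lamP] E : exists l : R, same_class G (rel_of E) ->
    smallest_eigenvalue (dirichlet R (rel_of E)) l.
  have [cl|ncl] := pselect (same_class G (rel_of E)); last by exists 0.
  have [[[ge _ _] _ I0] _] := cl.
  by have [l [le _]] := rayleigh_eigenvalue R ge I0; exists l.
have GG : `[< same_class G (rel_of [set q | G q.1 q.2]) >].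
  by apply/asboolP; rewrite rel_ofK; split.
have [E /asboolP clE Emin] := arg_minP lam (GG : [pred E | `[< same_class G (rel_of E) >]] _).
exists (rel_of E), (lam E); split=> //; first exact: lamP.
move=> e l' cl le'; pose E' := [set q | e q.1 q.2].
have cl' : same_class G (rel_of E') by rewrite rel_ofK.
apply: (le_trans (Emin E' _)); first exact/asboolP.
have [_] := lamP _ cl'; apply; rewrite rel_ofK; exact: le'.1.
Qed.

(** An eigenfunction of [H] pulled back along the isomorphism is a test function on [G] with the
    same energy and norm. *)
Lemma isomorphic_eigenvalue_le G H (lG lH : R) : simple_graph G -> simple_graph H ->
  interior G != set0 -> smallest_eigenvalue (dirichlet R G) lG ->
  eigenvalue (dirichlet R H) lH -> isomorphic G H -> lG <= lH.
Proof.
move=> gG gH IG leG /(eigenfunction gH)[f [sf [u fu] fl]] [s sE].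
pose g v := f (s v).
have sumE (F : 'I_n -> R) : \sum_v F (s v) = \sum_v F v.
  by rewrite [RHS](reindex_inj (@perm_inj _ s)).
have degE v : deg G v = deg H (s v).
  rewrite /deg -(card_imset _ (@perm_inj _ s)); apply: eq_card => w.
  rewrite inE; apply/imsetP/idP => [[x]|vw]; first by rewrite inE => vx ->; rewrite sE.
  by exists ((s^-1)%g w); rewrite ?permKV // inE -sE permKV.
have sg : supported G g by move=> v; rewrite inE degE => vI; apply: sf; rewrite inE.
have gn : sqnorm g = sqnorm f := sumE (fun v => f v ^+ 2).
have gE : energy G g = energy H f.
  rewrite /energy -(sumE (fun v => f v * lap H f v)); apply: eq_bigr => v _.
  congr (_ * _); rewrite /lap -(sumE (fun w => (H (s v) w)%:R * (f (s v) - f w))).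
  by apply: eq_bigr => w _; rewrite sE.
have := rayleigh_le gG IG leG sg; rewrite gn gE (energy_eigen sf fl).
by rewrite ler_pM2r // (sqnorm_gt0 fu).
Qed.

Lemma faber_krahnP G : tree_with_boundary G -> faber_krahn R G <-> SLO_star_tree G.
Proof.
move=> tb; split=> [|oG]; first exact: faber_krahn_SLO_star.
(* For the converse, a minimizer [H] of the class is an SLO*-tree by the first implication, hence
   isomorphic to [G], which so attains the minimum. *)
have [H [l [clH lH lmin]]] := exists_minimizer tb.
have [tbH HG] := clH.
have /(faber_krahn_SLO_star tbH) oH : faber_krahn R H.
  exists l; split=> // e l' [te eH]; apply: lmin; split=> //; exact: perm_trans eH HG.
have [[gG _ _] _ IG] := tb; have [[gH _ _] _ _] := tbH.
have [lG [leG _]] := rayleigh_eigenvalue R gG IG.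
exists lG; split=> // e l' cl le'; apply: le_trans (lmin e l' cl le').
exact: isomorphic_eigenvalue_le leG lH.1 (SLO_star_unique oG oH HG).
Qed.

End FaberKrahn.

Theorem theorem3 (R : realType) (n : nat) (G : rel 'I_n) :
  tree_with_boundary G ->
  (faber_krahn R G <-> SLO_star_tree G) /\
  (forall H : rel 'I_n, same_class G H -> faber_krahn R H -> faber_krahn R G ->
     isomorphic G H).
Proof.
move=> tb; split; first exact: faber_krahnP.
move=> H [tbH HG] /(faber_krahnP _ tbH) oH /(faber_krahnP _ tb) oG.
exact: SLO_star_unique.
Qed.
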